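(* Let $g\in C_w^k[0,\infty)$, let $l>0$, and suppose $\alpha=\alpha_n\to0$ as $\beta_n\to\infty$ (i.e. as $n\to\infty$). Then $$\lim_{n\to\infty}\ \sup_{x\ge0}\frac{\left|\mathcal{RL}_{n}^{[\alpha]}(g;x)-g(x)\right|}{(1+x^2)^{1+l}}=0.$$
   Context: Standing data: $(\beta_n)_{n\in\mathbb N}$ is a strictly increasing sequence of real numbers with $\beta_1=1$ and $\beta_n\to\infty$; $\phi,\psi$ are fixed reals with $0\le\phi\le\psi$; $\alpha=\alpha_n\ge 0$ is a sequence of nonnegative reals (the index $n$ is suppressed). For $i\ge1$ put $x^{(i,-\alpha)}=\prod_{j=1}^{i}(x+(j-1)\alpha)$, and $x^{(0,-\alpha)}=1$. For $x\ge0$ and locally integrable $g$ on $[0,\infty)$ for which the series converges absolutely (in particular for $g$ of at most polynomial growth) define $$\mathcal{RL}_{n}^{[\alpha]}(g;x)=\beta_n\sum_{i=0}^{\infty}(1+\beta_n\alpha)^{-x/\alpha}\left(\alpha+\frac{1}{\beta_n}\right)^{-i}\frac{x^{(i,-\alpha)}}{i!}\int_{i/\beta_n}^{(i+1)/\beta_n}g\left(\frac{\beta_n t+\phi}{\beta_n+\psi}\right)dt,$$ where for $\alpha=0$ the factor $(1+\beta_n\alpha)^{-x/\alpha}$ is read as its limit $e^{-\beta_n x}$. Let $w(x)=1+x^2$. $C_w^k[0,\infty)$ is the set of continuous $g:[0,\infty)\to\mathbb{R}$ with $|g(x)|\le Mw(x)$ for some constant $M>0$ and such that $\lim_{x\to\infty}|g(x)|/w(x)=k_g$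 exists and is finite ($k$ is only a label). *)

(* Defs.v *)
From HB Require Import structures.
From mathcomp Require Import all_boot all_order all_algebra.
From mathcomp Require Import all_classical all_reals all_analysis.
Import Order.TTheory GRing.Theory Num.Theory.
Import numFieldNormedType.Exports.

Set Implicit Arguments.
Unset Strict Implicit.
Unset Printing Implicit Defensive.

Local Open Scope classical_set_scope.
Local Open Scope ring_scope.

Section Operator.
Context {R : realType}.
Implicit Types (a b phi psi x : R) (g : R -> R).

(* x^{(i,-a)} = x (x + a) ... (x + (i-1) a); the paper's index j is j.+1 here *)
Definition rising a x (i : nat) : R := \prod_(j < i) (x + j%:R * a).

(* The branch a = 0 is the limit of (1 + b a)^(-x/a) as a tends to 0+; the
   library's x / 0 = 0 would give 1 instead. *)
Definition RLfactor b a x : R :=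
  if a == 0 then expR (- (b * x)) else (1 + b * a) `^ (- (x / a)).

Definition RLweight b a x (i : nat) : R :=
  RLfactor b a x * (a + b^-1) ^- i * (rising a x i / i`!%:R).

(* limn is total: the value is the sum of the series only when the series
   converges, as it does for g of at most polynomial growth. *)
Definition RL b a phi psi g x : R :=
  b * limn (series (fun i : nat => RLweight b a x i *
    \int[lebesgue_measure]_(t in `[i%:R / b, i.+1%:R / b])
      g ((b * t + phi) / (b + psi)))).

Definition w x : R := 1 + x ^+ 2.

(* Functions on [0, +oo[ are represented by functions on R whose values at
   negative arguments are irrelevant: continuity is that of the restriction. *)
Definition Cwk : set (R -> R) := [set g : R -> R |
  [/\ {within `[(0 : R), +oo[, continuous g},
      (exists2 M : R, 0 < M & forall x, 0 <= x -> `|g x| <= M * w x) &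
      exists k : R, `|g x| / w x @[x --> +oo] --> k]].

End Operator.

(* Main.v *)
Require Import Defs.
From HB Require Import structures.
From mathcomp Require Import all_boot all_order all_algebra.
From mathcomp Require Import all_classical all_reals all_analysis.
From mathcomp Require Import ring lra.
Import Order.TTheory GRing.Theory Num.Theory.
Import numFieldNormedType.Exports.
Local Open Scope classical_set_scope.
Local Open Scope ring_scope.

(* The weights are those of a negative binomial law (Poisson if a = 0) with mean
   b x and variance b x (1 + b a); as (b t + phi) / (b + psi) is within
   (|i - b x| + 1 + phi + psi x) / b of x on the i-th cell, the second moment of
   the operator about x is at most eta_n (1 + x^2) with eta_n tending to 0.
   A Korovkin estimate |g T - g x| <= e (1 + x^2)^(1+l) + K (T - x)^2, valid for
   all x, T >= 0, then bounds the weighted error by e + K eta_n: continuity and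
   compactness give it for small x, the quadratic growth of g for large x. *)

(** * Rising-factorial coefficients and their generating function *)

(** Taylor coefficients in s of (1 - a s)^(-x/a), or of exp(x s) when a = 0. *)
Definition rcoef {R : realType} (a x : R) (i : nat) : R := rising a x i / i`!%:R.

Lemma rcoef0 {R : realType} (a x : R) : rcoef a x 0 = 1.
Proof. by rewrite /rcoef /rising big_ord0 fact0 divr1. Qed.

Lemma rcoefS {R : realType} (a x : R) (i : nat) :
  i.+1%:R * rcoef a x i.+1 = (x + i%:R * a) * rcoef a x i.
Proof.
rewrite /rcoef /rising big_ord_recr/= factS natrM.
by field; rewrite nat1r !pnatr_eq0 -lt0n fact_gt0.
Qed.

(** Here the first factor of the product is taken out, whereas [rcoefS] takes out the last. This is
    the source of the shift from x to x + a in the moments. *)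
Lemma rcoefSl {R : realType} (a x : R) (i : nat) :
  i.+1%:R * rcoef a x i.+1 = x * rcoef a (x + a) i.
Proof.
rewrite /rcoef /rising big_ord_recl mul0r addr0 factS natrM.
have -> : \prod_(j < i) (x + (lift ord0 j)%:R * a) =
    \prod_(j < i) (x + a + j%:R * a).
  by apply: eq_bigr => j _; rewrite /= /bump -natr1; ring.
by field; rewrite nat1r !pnatr_eq0 -lt0n fact_gt0.
Qed.

Lemma rcoef_ge0 {R : realType} (a x : R) (i : nat) :
  0 <= a -> 0 <= x -> 0 <= rcoef a x i.
Proof.
move=> a0 x0; rewrite divr_ge0// prodr_ge0// => j _.
by rewrite addr_ge0// mulr_ge0.
Qed.

(** With h an antiderivative of -1/(1 - a s), the factor [expR (x * h t)] plays the role of the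
    reciprocal of the generating function. That function solves (1 - a s) y' = x y, and by [rcoefS]
    a truncated series fails this equation only in its top-degree term, so the derivative of the
    product telescopes to that term. *)
Lemma is_derive_expR_rcoef {R : realType} (a x s : R) (h : R -> R) (N : nat) :
  a * s != 1 -> is_derive s 1 h (- (1 - a * s)^-1) ->
  is_derive s 1
    (fun t => expR (x * h t) * series (fun i => rcoef a x i * t ^+ i) N.+1)
    (- (expR (x * h s) / (1 - a * s) * (N.+1%:R * rcoef a x N.+1 * s ^+ N))).
Proof.
move=> as1 hd.
have as0 : 1 - a * s != 0 by rewrite subr_eq0 eq_sym.
have Fd : is_derive s 1 (fun t => expR (x * h t))
    (- (x * expR (x * h s) / (1 - a * s))).
  have -> : - (x * expR (x * h s) / (1 - a * s)) =
      expR (x * h s) * (x *: - (1 - a * s)^-1).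
    by rewrite /GRing.scale/=; ring.
  by apply: (@is_derive1_comp _ expR (fun t => x * h t)); exact: is_deriveZ.
elim: N => [|N IH].
  rewrite [X in is_derive _ _ X _](_ : _ = (fun t => expR (x * h t))); last first.
    by apply/funext => t; rewrite /series/= big_nat1 rcoef0 expr0 !mulr1.
  apply: is_derive_eq.
  by rewrite rcoefS rcoef0; field.
pose S t := series (fun i => rcoef a x i * t ^+ i) N.+1.
rewrite [X in is_derive _ _ X _](_ : _ = (fun t => expR (x * h t) * S t +
    expR (x * h t) * (rcoef a x N.+1 * t ^+ N.+1))); last first.
  by apply/funext => t; rewrite seriesSr mulrDr.
rewrite rcoefS.
have Xd : is_derive s 1 (fun t : R => t ^+ N.+1) (N.+1%:R * s ^+ N).
  have := @is_deriveX _ _ id N.+1 s 1 1 (is_derive_id _ _).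
  by rewrite /GRing.scale/= mulr1 exprfctE.
apply: is_derive_eq.
rewrite /GRing.scale/= exprS.
by field.
Qed.

(** The product equals 1 at 0, so the mean value theorem on [0, u] turns the telescoped derivative
    into an explicit remainder. *)
Lemma expR_rcoef_MVT {R : realType} (a x u : R) (h : R -> R) (N : nat) :
  0 <= u -> a * u < 1 -> 0 <= a -> h 0 = 0 ->
  (forall s, 0 <= s <= u -> is_derive s 1 h (- (1 - a * s)^-1)) ->
  exists2 s, 0 <= s <= u &
    expR (x * h u) * series (fun i => rcoef a x i * u ^+ i) N.+1 =
    1 - expR (x * h s) / (1 - a * s) * (N.+1%:R * rcoef a x N.+1 * s ^+ N) * u.
Proof.
move=> u0 au1 a0 h0 hd.
have as1 s : 0 <= s <= u -> a * s != 1.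
  move=> /andP[_ su]; rewrite lt_eqF// (le_lt_trans _ au1)//.
  exact: ler_wpM2l.
pose f t := expR (x * h t) * series (fun i => rcoef a x i * t ^+ i) N.+1.
pose df s := - (expR (x * h s) / (1 - a * s) *
  (N.+1%:R * rcoef a x N.+1 * s ^+ N)).
have fd s : 0 <= s <= u -> is_derive s 1 f (df s).
  by move=> su; apply: is_derive_expR_rcoef; [exact: as1|exact: hd].
have [s||s su] := MVT_segment u0 (f := f) (df := df).
- by rewrite in_itv/= => /andP[s0 su]; apply: fd; rewrite !ltW.
- apply: derivable_within_continuous => s; rewrite in_itv/= => su.
  by have [] := fd s su.
rewrite subr0 => fE; exists s; first by rewrite in_itv in su.
rewrite -mulNr -[X in 1 + X]fE /f h0 mulr0 expR0 mul1r.
rewrite [X in _ - X](_ : _ = 1) ?[1 + _]addrC ?subrK//.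
rewrite /series/= big_nat_recl// rcoef0 expr0 mulr1 big1 ?addr0// => i _.
by rewrite exprS mul0r mulr0.
Qed.

Lemma cvg_expR_rcoef {R : realType} (a x u : R) (h : R -> R) :
  0 <= x -> 0 <= u -> a * u < 1 -> 0 <= a -> h 0 = 0 ->
  (forall s, 0 <= s <= u -> h s <= 0) ->
  (forall s, 0 <= s <= u -> is_derive s 1 h (- (1 - a * s)^-1)) ->
  expR (x * h u) * series (fun i => rcoef a x i * u ^+ i) N @[N --> \oo] --> (1 : R).
Proof.
move=> x0 u0 au1 a0 h0 hle hd.
(* The error term of expR_rcoef_MVT is nonnegative, so partial sums are bounded
   and the general term tends to 0; at x + a instead of x, this says that the
   error term itself vanishes, by rcoefSl. *)
have as_lt1 s : 0 <= s <= u -> a * s < 1.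
  by move=> /andP[_ su]; rewrite (le_lt_trans _ au1)// ler_wpM2l.
have term_ge0 y i : 0 <= y -> 0 <= rcoef a y i * u ^+ i.
  by move=> y0; rewrite mulr_ge0 ?exprn_ge0// rcoef_ge0.
have term_cvg0 y : 0 <= y -> rcoef a y i * u ^+ i @[i --> \oo] --> (0 : R).
  move=> y0; apply: cvg_series_cvg_0; apply: nondecreasing_is_cvgn.
    by apply: nondecreasing_series => i _ _; exact: term_ge0.
  exists (expR (y * h u))^-1 => _ [N _ <-].
  apply: (@le_trans _ _ (series (fun i => rcoef a y i * u ^+ i) N.+1)).
    by rewrite seriesSr lerDl term_ge0.
  rewrite -[leRHS]mul1r ler_pdivlMr ?expR_gt0// mulrC.
  have [s su ->] := expR_rcoef_MVT a y u h N u0 au1 a0 h0 hd.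
  rewrite gerBl; apply: mulr_ge0 => //; apply: mulr_ge0.
    by rewrite divr_ge0 ?expR_ge0// subr_ge0 ltW// as_lt1.
  by case/andP: su => s0 _; rewrite mulr_ge0 ?exprn_ge0// mulr_ge0// rcoef_ge0.
rewrite -cvg_shiftS.
have bound0 :
    x * u / (1 - a * u) * (rcoef a (x + a) N * u ^+ N) @[N --> \oo] --> (0 : R).
  rewrite -[X in _ --> X](mulr0 (x * u / (1 - a * u))).
  by apply: cvgMr; apply: term_cvg0; rewrite addr_ge0.
have lower : 1 - x * u / (1 - a * u) * (rcoef a (x + a) N * u ^+ N)
    @[N --> \oo] --> (1 : R).
  by rewrite -[X in _ --> X]subr0; apply: cvgB => //; exact: cvg_cst.
apply: (squeeze_cvgr _ lower); last exact: (@cvg_cst _ (1 : R)).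
apply: nearW => N /=.
have [s su ->] := expR_rcoef_MVT a x u h N u0 au1 a0 h0 hd.
have asu : a * s <= a * u by case/andP: su => *; rewrite ler_wpM2l.
have as1 := as_lt1 s su.
case/andP: (su) => s0 su'.
apply/andP; split; last first.
  rewrite gerBl; apply: mulr_ge0 => //; apply: mulr_ge0.
    by rewrite divr_ge0 ?expR_ge0// subr_ge0 ltW.
  by rewrite mulr_ge0 ?exprn_ge0// mulr_ge0// rcoef_ge0.
(* The factors of the remainder depending on s are replaced by their values at u, except the
   exponential, which is at most 1 since h <= 0 and x >= 0. *)
rewrite lerB// rcoefSl.
rewrite (_ : x * u / (1 - a * u) * _ =
  1 / (1 - a * u) * (x * rcoef a (x + a) N * u ^+ N) * u); last by ring.
have c0 : 0 <= rcoef a (x + a) N by rewrite rcoef_ge0// addr_ge0.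
apply: ler_wpM2r => //; apply: ler_pM.
- by rewrite divr_ge0 ?expR_ge0// subr_ge0 ltW.
- by rewrite mulr_ge0 ?exprn_ge0// mulr_ge0.
- apply: ler_pM; first exact: expR_ge0.
  + by rewrite invr_ge0 subr_ge0 ltW.
  + by rewrite -expR0 ler_expR mulr_ge0_le0// hle.
  + by rewrite lef_pV2 ?posrE ?subr_gt0// lerB.
- apply: ler_wpM2l; first exact: mulr_ge0.
  by rewrite lerXn2r.
Qed.

(** * Operations on convergent series *)

Lemma cvg_series0S {R : realType} (f : R ^nat) (s : R) : f 0%N = 0 ->
  series (fun i => f i.+1) @ \oo --> s -> series f @ \oo --> s.
Proof.
move=> f0 fs; rewrite -cvg_shiftS.
rewrite (_ : [sequence _]_n = series (fun i => f i.+1))//; apply/funext => n.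
by rewrite /series/= big_nat_recl// f0 add0r.
Qed.

Lemma cvg_seriesD {R : realType} (f g : R ^nat) (s t : R) :
  series f @ \oo --> s -> series g @ \oo --> t ->
  series (fun i => f i + g i) @ \oo --> s + t.
Proof. by move=> fs gt; rewrite (seriesD f g); exact: cvgD. Qed.

Lemma cvg_seriesZ {R : realType} (f : R ^nat) (k s : R) :
  series f @ \oo --> s -> series (fun i => k * f i) @ \oo --> k * s.
Proof. by move=> fs; rewrite (seriesZ f k); exact: cvgMr. Qed.

(** * Total mass, mean and variance of the weights *)

Section weight.
Context {R : realType}.
Implicit Types a b x : R.

Lemma RLweight_ge0 b a x i : 0 < b -> 0 <= a -> 0 <= x -> 0 <= RLweight b a x i.
Proof.
move=> b0 a0 x0; apply: mulr_ge0; last exact: rcoef_ge0.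
rewrite mulr_ge0// ?invr_ge0 ?exprn_ge0 ?addr_ge0 ?invr_ge0 ?(ltW b0)//.
by rewrite /RLfactor; case: ifP => _; rewrite ?expR_ge0 ?powR_ge0.
Qed.

Lemma RLfactorS b a x : 0 < b -> 0 <= a ->
  RLfactor b a x = (1 + b * a) * RLfactor b a (x + a).
Proof.
move=> b0 a0; rewrite /RLfactor; case: eqVneq => [->|an0].
  by rewrite mulr0 !addr0 mul1r.
have ba0 : 0 < 1 + b * a by rewrite ltr_wpDr// mulr_ge0 ?(ltW b0).
rewrite -[X in _ = X * _](powRr1 (ltW ba0)) -powRD; last first.
  by apply/implyP => _; rewrite gt_eqF.
by congr (_ `^ _); field.
Qed.

(** Taking x out of the rising factorial moves x to x + a; the change 1 + b a of [RLfactor] and one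
    power of a + 1/b combine to b. Multiplying by the index thus gives a multiple of the law at x +
    a, so factorial moments reduce to total masses at shifted points. *)
Lemma RLweightS b a x i : 0 < b -> 0 <= a ->
  i.+1%:R * RLweight b a x i.+1 = b * x * RLweight b a (x + a) i.
Proof.
move=> b0 a0; rewrite /RLweight -/(rcoef _ _ _) -/(rcoef _ _ _) RLfactorS//.
rewrite [LHS]mulrCA rcoefSl exprS.
field.
have ab0 : 0 < a + b^-1 by rewrite ltr_wpDl// invr_gt0.
have ab1 : 0 < a * b + 1 by rewrite ltr_wpDl// mulr_ge0// ltW.
by rewrite expf_neq0 !gt_eqF.
Qed.

Lemma cvg_series_RLweight b a x : 0 < b -> 0 <= a -> 0 <= x ->
  series (RLweight b a x) @ \oo --> (1 : R).
Proof.
move=> b0 a0 x0.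
(* The series of weights is the generating series at u, normalised: 1 - a u = 1 / (1 + b a), so
   [expR (x * h u)] is exactly [RLfactor b a x], in both cases of its definition. *)
pose u := (a + b^-1)^-1.
pose h s := if a == 0 then - s else ln (1 - a * s) / a.
have ab0 : 0 < a + b^-1 by rewrite ltr_wpDl// invr_gt0.
have u0 : 0 <= u by rewrite invr_ge0 ltW.
have ba1 : 0 < 1 + b * a by rewrite ltr_wpDr// mulr_ge0// ltW.
have auE : 1 - a * u = (1 + b * a)^-1.
  by rewrite /u; field; rewrite !gt_eqF.
have au1 : a * u < 1 by rewrite -subr_gt0 auE invr_gt0.
have as1 s : 0 <= s <= u -> 0 < 1 - a * s <= 1.
  move=> /andP[s0 su]; rewrite subr_gt0 gerBl mulr_ge0// andbT.
  by rewrite (le_lt_trans _ au1)// ler_wpM2l.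
have FE : RLfactor b a x = expR (x * h u).
  rewrite /RLfactor /h; case: eqVneq => [a_eq0|an0].
    by rewrite /u a_eq0 add0r invrK mulrN mulrC.
  rewrite auE /powR gt_eqF//.
  rewrite lnV ?posrE//.
  by congr expR; ring.
have -> : series (RLweight b a x) =
    (fun N => expR (x * h u) * series (fun i => rcoef a x i * u ^+ i) N).
  apply/funext => N; rewrite /series/= mulr_sumr; apply: eq_bigr => i _.
  by rewrite /RLweight FE -exprVn -mulrA [X in _ * X]mulrC.
apply: cvg_expR_rcoef => //.
- by rewrite /h mulr0 subr0 ln1 mul0r oppr0 if_same.
- move=> s /[dup] su /as1/andP[s0 s1]; rewrite /h; case: ifP => _.
    by rewrite oppr_le0; case/andP : su.
  by rewrite mulr_le0_ge0 ?invr_ge0// ln_le0.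
- move=> s /as1/andP[s0 _].
  rewrite /h; case: eqVneq => [->|an0].
    rewrite mul0r subr0 invr1; exact: is_deriveN.
  have lnd : is_derive (1 - a * s) 1 (@ln R) (1 - a * s)^-1.
    exact: is_derive1_ln.
  have ad : is_derive s 1 (fun t : R => 1 - a * t) (- a).
    by apply: is_derive_eq; rewrite /GRing.scale/=; ring.
  have lad : is_derive s 1 (fun t : R => ln (1 - a * t)) ((1 - a * s)^-1 * - a).
    exact: (@is_derive1_comp _ (@ln R) (fun t : R => 1 - a * t)).
  by apply: is_derive_eq; rewrite /GRing.scale/=; field; rewrite an0 gt_eqF.
Qed.

Lemma cvg_series_RLweight1 b a x : 0 < b -> 0 <= a -> 0 <= x ->
  series (fun i => i%:R * RLweight b a x i) @ \oo --> b * x.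
Proof.
move=> b0 a0 x0; apply: cvg_series0S; first by rewrite mul0r.
rewrite (_ : (fun i => _) = (fun i => b * x * RLweight b a (x + a) i)).
  have /(cvg_seriesZ _ (b * x)) := cvg_series_RLweight _ _ _ b0 a0 (addr_ge0 x0 a0).
  by rewrite mulr1.
by apply/funext => i; rewrite RLweightS.
Qed.

Lemma cvg_series_RLweight2 b a x : 0 < b -> 0 <= a -> 0 <= x ->
  series (fun i => i%:R * (i%:R - 1) * RLweight b a x i) @ \oo -->
    b * x * (b * (x + a)).
Proof.
move=> b0 a0 x0; apply: cvg_series0S; first by rewrite !mul0r.
rewrite (_ : (fun i => _) =
    (fun i => b * x * (i%:R * RLweight b a (x + a) i))); last first.
  apply/funext => i.
  by rewrite [RHS]mulrCA -RLweightS// -natr1; ring.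
by apply: cvg_seriesZ; apply: cvg_series_RLweight1 => //; rewrite addr_ge0.
Qed.

Lemma cvg_series_RLvariance b a x : 0 < b -> 0 <= a -> 0 <= x ->
  series (fun i => (i%:R - b * x) ^+ 2 * RLweight b a x i) @ \oo -->
    b * x * (1 + b * a).
Proof.
move=> b0 a0 x0.
(* With m = b x, (i - m)^2 = m^2 + (1 - 2m) i + i (i - 1), which needs only the factorial moments of
   order at most 2. *)
have c0 := cvg_seriesZ _ ((b * x) ^+ 2) _ (cvg_series_RLweight _ _ _ b0 a0 x0).
have c1 := cvg_seriesZ _ (1 - b * x *+ 2) _ (cvg_series_RLweight1 _ _ _ b0 a0 x0).
have c2 := cvg_series_RLweight2 _ _ _ b0 a0 x0.
have := cvg_seriesD _ _ _ _ (cvg_seriesD _ _ _ _ c0 c1) c2.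
rewrite (_ : _ + _ + _ = b * x * (1 + b * a)); last by ring.
rewrite (_ : (fun i => _) = (fun i => (i%:R - b * x) ^+ 2 * RLweight b a x i))//.
by apply/funext => i; ring.
Qed.

(** * Cell averages and the error of the operator at a point *)

Lemma normr_average_le (G : R -> R) (p q y c : R) : p < q ->
  {within `[p, q], continuous G} ->
  (forall t, p <= t <= q -> `|G t - y| <= c) ->
  `|(q - p)^-1 * \int[lebesgue_measure]_(t in `[p, q]) G t - y| <= c.
Proof.
move=> pq cG Gy.
have qp0 : 0 < q - p by rewrite subr_gt0.
have mpq : measurable (`[p, q]%classic : set R) by [].
have intG : lebesgue_measure.-integrable `[p, q] (EFin \o G).
  by apply: continuous_compact_integrable => //; exact: segment_compact.
have intc (k : R) : lebesgue_measure.-integrable `[p, q] (EFin \o cst k).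
  apply: continuous_compact_integrable; first exact: segment_compact.
  exact/continuous_subspaceT/cst_continuous.
have cE (k : R) : \int[lebesgue_measure]_(t in `[p, q]) (cst k t) = k * (q - p).
  by rewrite Rintegral_cst//= lebesgue_measure_itv/= lte_fin pq.
rewrite -(ler_pM2l qp0) -[X in X * `|_|](gtr0_norm qp0) -normrM mulrBr.
rewrite mulVKf ?gt_eqF// ler_distl; apply/andP; split.
  rewrite (_ : _ - _ = (y - c) * (q - p)); last by ring.
  rewrite -cE; apply: le_Rintegral => // t; rewrite /= in_itv/= => /Gy.
  by rewrite ler_distl => /andP[].
rewrite (_ : _ + _ = (y + c) * (q - p)); last by ring.
rewrite -cE; apply: le_Rintegral => // t; rewrite /= in_itv/= => /Gy.
by rewrite ler_distl => /andP[].
Qed.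
End weight.

(** Since g is continuous only as a restriction, the affine argument of g must be known to send the
    cell into the half-line. *)
Lemma cvg_affine_within {R : realType} (k m : R) (A B : set R) (g : R -> R) :
  (forall t, A t -> B (k * t + m)) -> {within B, continuous g} ->
  {within A, continuous (fun t => g (k * t + m))}.
Proof.
move=> AB /subspace_continuousP gB; apply/subspace_continuousP => t At.
apply: (@cvg_comp _ _ _ (fun s => k * s + m) g _ (within B (nbhs (k * t + m)))).
  have aff : (k * s + m) @[s --> t] --> k * t + m.
    by apply: cvgD; [exact: mulrl_continuous|exact: cvg_cst].
  move=> U /aff; exact: (@filterS _ (nbhs t) _ _ _ (fun s h As => h (AB s As))).
by apply: gB; exact: AB.
Qed.

(** Integrating the quadratic estimate against the weights: the total mass 1 reproduces e, while K
    multiplies a bound on the second moment about x. Both e and K may depend on x. *)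
Lemma RL_dist {R : realType} (b a phi psi e K x : R) (g : R -> R) :
  0 < b -> 0 <= a -> 0 <= phi -> phi <= psi -> 0 <= x -> 0 <= K ->
  {within `[0, +oo[, continuous g} ->
  (forall T, 0 <= T -> `|g T - g x| <= e + K * (T - x) ^+ 2) ->
  `|RL b a phi psi g x - g x| <=
    e + K * (3 / b ^+ 2 *
      (b * x * (1 + b * a) + ((1 + phi) ^+ 2 + (psi * x) ^+ 2))).
Proof.
move=> b0 a0 phi0 phipsi x0 K0 cg gle.
have psi0 : 0 <= psi by exact: le_trans phipsi.
have bpsi0 : 0 < b + psi by rewrite ltr_wpDr.
pose I i := \int[lebesgue_measure]_(t in `[i%:R / b, i.+1%:R / b])
  g ((b * t + phi) / (b + psi)).
pose r := (1 + phi) ^+ 2 + (psi * x) ^+ 2.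
pose D i := e + K * (3 / b ^+ 2 * ((i%:R - b * x) ^+ 2 + r)).
have dD i : `|b * I i - g x| <= D i.
  (* The cells have length 1/b, so b times the integral is an average. *)
  have -> : b = (i.+1%:R / b - i%:R / b)^-1.
    by rewrite -mulrBl -natr1 addrAC subrr add0r mul1r invrK.
  apply: normr_average_le.
  - by rewrite ltr_pM2r ?invr_gt0// ltr_nat.
  - have -> : (fun t => g ((b * t + phi) / (b + psi))) =
        (fun t => g (b / (b + psi) * t + phi / (b + psi))).
      by apply/funext => t; rewrite mulrDl mulrAC.
    apply: (@cvg_affine_within _ _ _ _ `[0, +oo[%classic) => //.
    move=> t /=; rewrite !in_itv/= andbT => /andP[it _].
    have t0 : 0 <= t by apply: le_trans it; rewrite divr_ge0// ltW.
    by rewrite addr_ge0// mulr_ge0// ?divr_ge0// ?invr_ge0 ltW.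
  - move=> t; rewrite ler_pdivrMr// ler_pdivlMr// => /andP[it ti].
    have t0 : 0 <= t * b by apply: le_trans it.
    apply: le_trans (gle _ _) _.
      by rewrite divr_ge0 ?(ltW bpsi0)// addr_ge0// mulrC.
    rewrite lerD2l ler_wpM2l//.
    rewrite (_ : _ - x = (t * b + phi - (b + psi) * x) / (b + psi)); last first.
      by field; rewrite gt_eqF.
    rewrite expr_div_n ler_pdivrMr ?exprn_gt0//.
    apply: (@le_trans _ _ (3 * ((i%:R - b * x) ^+ 2 + r))); last first.
      rewrite (_ : 3 / b ^+ 2 * _ * _ = 3 * ((i%:R - b * x) ^+ 2 + r) *
        ((b ^+ 2)^-1 * (b + psi) ^+ 2)); last by ring.
      rewrite ler_peMr//.
        by rewrite mulr_ge0// /r !addr_ge0// sqr_ge0.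
      rewrite ler_pdivlMl ?exprn_gt0// mulr1.
      by rewrite lerXn2r ?nnegrE ?(ltW b0) ?(ltW bpsi0)// lerDl.
    rewrite -natr1 in ti; rewrite /r.
    have : (t * b - i%:R + phi) ^+ 2 <= (1 + phi) ^+ 2.
      by rewrite lerXn2r ?nnegrE; lra.
    (* The displacement, scaled by b + psi, splits into the deviation of the index from its mean, an
       offset between 0 and 1 + phi, and the drift psi x. The constant 3 comes from squaring a sum
       of three terms. *)
    rewrite (_ : t * b + _ - _ =
      (i%:R - b * x) + (t * b - i%:R + phi) - psi * x); last by ring.
    move: (t * b - i%:R + phi) (i%:R - b * x) (psi * x) => p y z p2.
    (* The three squares add up to 3 (y^2 + p^2 + z^2) - (y + p - z)^2. *)
    have := sqr_ge0 (y - p); have := sqr_ge0 (y + z); have := sqr_ge0 (p + z).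
    lra.
have sD : series (fun i => RLweight b a x i * D i) @ \oo -->
    e + K * (3 / b ^+ 2 * (b * x * (1 + b * a) + r)).
  have c0 := cvg_series_RLweight _ _ _ b0 a0 x0.
  have cv := cvg_series_RLvariance _ _ _ b0 a0 x0.
  have := cvg_seriesD _ _ _ _
    (cvg_seriesZ _ (e + K * (3 / b ^+ 2 * r)) _ c0)
    (cvg_seriesZ _ (K * (3 / b ^+ 2)) _ cv).
  rewrite (_ : _ + _ * (b * x * (1 + b * a)) =
    e + K * (3 / b ^+ 2 * (b * x * (1 + b * a) + r))); last by ring.
  rewrite (_ : (fun i => _) = (fun i => RLweight b a x i * D i))//.
  by apply/funext => i; rewrite /D; ring.
have sDl : cvgn (series (fun i => RLweight b a x i * D i)).
  by apply/cvg_ex; eexists; exact: sD.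
pose d i := RLweight b a x i * (b * I i - g x).
have dleD i : `|d i| <= RLweight b a x i * D i.
  by rewrite normrM ger0_norm ?RLweight_ge0// ler_wpM2l// RLweight_ge0.
have ncd : cvgn [normed series d].
  by apply: (series_le_cvg _ _ dleD sDl) => // i; exact: le_trans (dleD i).
have cd := normed_cvg ncd.
(* Total mass 1 allows centring each average at g x. The series in [RL] is recovered from two
   convergent series, so its [limn] is a genuine sum and not a default value. *)
have -> : RL b a phi psi g x - g x = limn (series d).
  have c0 := cvg_series_RLweight _ _ _ b0 a0 x0.
  have := cvg_seriesZ _ b^-1 _ (cvg_seriesD _ _ _ _ cd (cvg_seriesZ _ (g x) _ c0)).
  rewrite (_ : (fun i => _) = (fun i => RLweight b a x i * I i)); last first.
    by apply/funext => i; rewrite /d; field; rewrite gt_eqF.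
  move=> /cvg_lim; rewrite /RL -/(I _) => ->//.
  by field; rewrite gt_eqF.
apply: le_trans (lim_series_norm ncd) _.
rewrite -(cvg_lim _ sD)//.
exact: lim_series_le.
Qed.

(** * Korovkin estimates for functions of quadratic growth *)

(** From T^2 <= 2 x^2 + 2 (T - x)^2, which is (T - 2x)^2 >= 0, one gets w T <= 2 w x + 2 (T -
    x)^2. *)
Lemma growth_dist {R : realType} (M x T : R) (g : R -> R) : 0 < M ->
  (forall y, 0 <= y -> `|g y| <= M * w y) -> 0 <= x -> 0 <= T ->
  `|g T - g x| <= 3 * M * w x + 2 * M * (T - x) ^+ 2.
Proof.
move=> M0 gM x0 T0; apply: (le_trans (ler_normB _ _)).
apply: (le_trans (lerD (gM _ T0) (gM _ x0))).
rewrite -mulrDr (_ : _ + _ = M * (3 * w x + 2 * (T - x) ^+ 2)); last by ring.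
rewrite ler_pM2l// /w; have := sqr_ge0 (T - x *+ 2); have := sqr_ge0 x.
by nra.
Qed.

(* Near a point x the bound e controls nearby T by continuity, and the
   quadratic term controls far T by the growth bound; compactness of [0, A]
   makes K uniform. *)
Lemma dist_le_quadratic_segment {R : realType} (M e A : R) (g : R -> R) :
  0 < M -> 0 < e -> {within `[0, +oo[, continuous g} ->
  (forall y, 0 <= y -> `|g y| <= M * w y) ->
  exists2 K, 0 <= K & forall x T, 0 <= x <= A -> 0 <= T ->
    `|g T - g x| <= e + K * (T - x) ^+ 2.
Proof.
move=> M0 e0 cg gM.
(* Asking for all large K instead of one K puts the claim in the near-covering form of compactness,
   which makes the local thresholds uniform. *)
suff : \forall K \near pinfty_nbhs R, `[0, A]%classic `<=`
    [set x | forall T, 0 <= T -> `|g T - g x| <= e + K * (T - x) ^+ 2].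
  move=> H; near (pinfty_nbhs R) => K.
  exists K; first by near: K; exact: nbhs_pinfty_ge.
  by move=> x T xA; move: x xA T; near: K.
have /compact_near_coveringP/near_covering_withinP cov :
  compact `[0, A]%classic by exact: segment_compact.
apply: cov => x0 /=; rewrite in_itv/= => /andP[x00 x0A].
have e20 : 0 < e / 2 by rewrite divr_gt0.
have /subspace_continuousP/(_ x0) : {within `[0, +oo[, continuous g} by [].
rewrite /= in_itv/= x00 => /(_ isT) /cvgrPdist_le/(_ _ e20).
case => d /= d0 gd.
have {}gd y : 0 <= y -> `|x0 - y| < d -> `|g x0 - g y| <= e / 2.
  by move=> y0 yd; apply: gd => //; rewrite /= in_itv/= y0.
(* For x within d/2 of x0 and T at distance at least d from x0, |T - x| >= d/2, so 1 <= 4 (T - x)^2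
   / d^2. This factor absorbs the term 3 M w x of [growth_dist], as w x <= w (x0 + d). *)
pose K0 := 3 * M * w (x0 + d) * 4 / d ^+ 2 + 2 * M.
exists ([set x | `|x0 - x| < d / 2], [set K | K0 <= K]); first split => /=.
- by exists (d / 2) => //=; rewrite divr_gt0.
- by apply: nbhs_pinfty_ge; exact: num_real.
case=> x K /= [xd KK0]; rewrite in_itv/= => /andP[x_ge0 xA] T T0.
have Td : 0 <= K0 * (T - x) ^+ 2 <= K * (T - x) ^+ 2.
  rewrite ler_wpM2r ?sqr_ge0// andbT mulr_ge0 ?sqr_ge0// /K0 /w.
  by rewrite addr_ge0 ?mulr_ge0 ?invr_ge0 ?sqr_ge0 ?addr_ge0 ?sqr_ge0 ?ltW.
case/andP: Td => KT0 KTK.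
have [Tnear|Tfar] := ltP `|x0 - T| d.
  have gT := gd _ T0 Tnear.
  have gx : `|g x0 - g x| <= e / 2.
    by apply: gd => //; apply: lt_trans xd _; rewrite ltr_pdivrMr// mulr_natr; lra.
  apply: (@le_trans _ _ e); last by rewrite lerDl (le_trans KT0).
  apply: le_trans (ler_distD (g x0) _ _) _.
  by rewrite distrC; lra.
apply: le_trans (growth_dist M x T g M0 gM x_ge0 T0) _.
apply: (@le_trans _ _ (K0 * (T - x) ^+ 2)); last first.
  by apply: (le_trans KTK); rewrite lerDr ltW.
rewrite /K0 [leRHS]mulrDl lerD2r.
have xTd : d / 2 <= `|T - x|.
  have := ler_distD x x0 T; rewrite (distrC x T); lra.
have xTd2 : d ^+ 2 <= 4 * (T - x) ^+ 2.
  rewrite -(real_normK (num_real (T - x))).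
  rewrite (_ : 4 * _ = (2 * `|T - x|) ^+ 2); last by ring.
  by rewrite lerXn2r ?nnegrE; lra.
have wx : w x <= w (x0 + d).
  rewrite /w lerD2l lerXn2r ?nnegrE//; first by lra.
  by move: xd; rewrite ltr_distl => /andP[]; lra.
rewrite (_ : _ / _ * _ = 3 * M * w (x0 + d) * (4 * (T - x) ^+ 2 / d ^+ 2)); last by ring.
have w0 : 0 <= w x by rewrite /w addr_ge0// sqr_ge0.
rewrite -[leLHS]mulr1; apply: ler_pM => //.
- by rewrite !mulr_ge0// ltW.
- by rewrite ler_wpM2l// mulr_ge0// ltW.
- by rewrite ler_pdivlMr ?exprn_gt0// mul1r.
Unshelve. all: by end_near.
Qed.

(** The cut is at A = (3M/e)^(1/l). Above it, w x >= x > A gives (w x)^l >= 3M/e, so e (w x)^(1+l)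
    dominates the term 3 M w x of [growth_dist]. Below it, the estimate on the segment suffices
    because w >= 1. *)
Lemma dist_le_weighted {R : realType} (M e l : R) (g : R -> R) :
  0 < M -> 0 < e -> 0 < l -> {within `[0, +oo[, continuous g} ->
  (forall y, 0 <= y -> `|g y| <= M * w y) ->
  exists2 K, 0 <= K & forall x T, 0 <= x -> 0 <= T ->
    `|g T - g x| <= e * w x `^ (1 + l) + K * (T - x) ^+ 2.
Proof.
move=> M0 e0 l0 cg gM.
have Me0 : 0 < 3 * M / e by rewrite divr_gt0// mulr_gt0.
have [K K0 gK] :=
  dist_le_quadratic_segment M e ((3 * M / e) `^ l^-1) g M0 e0 cg gM.
exists (K + 2 * M) => [|x T x0 T0]; first by rewrite addr_ge0// mulr_ge0// ltW.
have wge1 : 1 <= w x by rewrite /w lerDl sqr_ge0.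
have w0 : 0 < w x by exact: lt_le_trans wge1.
have wD : w x `^ (1 + l) = w x * w x `^ l.
  by rewrite powRD ?powRr1 ?(ltW w0)//; apply/implyP => _; rewrite gt_eqF.
have wl1 : 1 <= w x `^ l.
  by rewrite -(powRr0 (w x)); apply: ler_powR => //; exact: ltW.
have Tx0 := sqr_ge0 (T - x).
rewrite wD.
have [xA|Ax] := leP x ((3 * M / e) `^ l^-1).
  apply: le_trans (gK _ _ _ T0) _; first by rewrite x0.
  apply: lerD; last first.
    by rewrite ler_wpM2r// lerDl mulr_ge0// ltW.
  by rewrite ler_peMr ?(ltW e0)// mulr_ege1.
apply: le_trans (growth_dist M x T g M0 gM x0 T0) _.
apply: lerD; last by rewrite ler_wpM2r// lerDr.
have Mel : 3 * M / e <= w x `^ l.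
  have -> : 3 * M / e = ((3 * M / e) `^ l^-1) `^ l.
    by rewrite -powRrM mulVf ?gt_eqF// powRr1 ?ltW.
  have xw : x <= w x by rewrite /w; have := sqr_ge0 (x - 1); nra.
  apply: (ge0_ler_powR (ltW l0)); rewrite ?nnegrE ?powR_ge0 ?(ltW w0)//.
  exact: le_trans (ltW Ax) xw.
rewrite [leRHS]mulrCA [leLHS]mulrC ler_pM2l//.
by rewrite -ler_pdivrMl// mulrC.
Qed.

(** * Uniform error bound and passage to the limit *)

(** Each of 1, x and x^2 is at most w x; what remains in front of w x is free of x and vanishes as
    1/b and a tend to 0. *)
Lemma RL_error_le {R : realType} (b a x phi psi : R) :
  0 < b -> 0 <= a -> 0 <= x ->
  3 / b ^+ 2 * (b * x * (1 + b * a) + ((1 + phi) ^+ 2 + (psi * x) ^+ 2)) <=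
  3 * (b^-1 + a + ((1 + phi) ^+ 2 + psi ^+ 2) * b^-1 ^+ 2) * w x.
Proof.
move=> b0 a0 x0.
rewrite (_ : 3 / b ^+ 2 * _ = 3 * (b^-1 * x + a * x +
    (1 + phi) ^+ 2 * b^-1 ^+ 2 + psi ^+ 2 * b^-1 ^+ 2 * x ^+ 2)); last first.
  by field; rewrite gt_eqF.
rewrite -[leRHS]mulrA ler_pM2l// !mulrDl.
have xw : x <= w x by rewrite /w; have := sqr_ge0 (x - 1); nra.
have w1 : 1 <= w x by rewrite /w lerDl sqr_ge0.
have x2w : x ^+ 2 <= w x by rewrite /w lerDr.
have bV : 0 <= b^-1 by rewrite invr_ge0 ltW.
rewrite -!addrA !lerD ?ler_wpM2l//.
- by rewrite ler_peMr// mulr_ge0// sqr_ge0.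
- by rewrite mulr_ge0// sqr_ge0.
Qed.

Theorem theorem5p2 (R : realType) (beta alpha : nat -> R) (phi psi : R)
  (beta_incr : forall m n : nat, (0 < m)%N -> (m < n)%N -> beta m < beta n)
  (beta1 : beta 1%N = 1)
  (beta_oo : beta n @[n --> \oo] --> +oo)
  (phi_ge0 : 0 <= phi) (phi_le_psi : phi <= psi)
  (alpha_ge0 : forall n : nat, (0 < n)%N -> 0 <= alpha n)
  (alpha_to0 : alpha n @[n --> \oo] --> (0 : R))
  (g : R -> R) (g_Cwk : Cwk g)
  (l : R) (l_gt0 : 0 < l) :
  ereal_sup [set (`|RL (beta n) (alpha n) phi psi g x - g x|
                    / (1 + x ^+ 2) `^ (1 + l))%:E | x in `[0, +oo[%classic]
    @[n --> \oo] --> 0%E.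
Proof.
case: g_Cwk => cg [M M0 gM] _.
pose eta n := 3 * ((beta n)^-1 + alpha n +
  ((1 + phi) ^+ 2 + psi ^+ 2) * (beta n)^-1 ^+ 2).
(* The value [beta 0] is unconstrained, so positivity is claimed only for large n. *)
have beta_gt0 : \forall n \near \oo, 0 < beta n.
  by move/cvgryPgt : beta_oo; exact.
have betaV0 : (beta n)^-1 @[n --> \oo] --> (0 : R).
  by apply/gtr0_cvgV0 => //; exact: beta_gt0.
have eta0 : eta n @[n --> \oo] --> (0 : R).
  rewrite -(mulr0 3) -(addr0 0) -{1}(addr0 0).
  rewrite -[X in 3 * (_ + X)](mulr0 ((1 + phi) ^+ 2 + psi ^+ 2)).
  apply: cvgMr; apply: cvgD; first exact: cvgD.
  apply: cvgMr; rewrite -[X in _ --> X](mulr0 0).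
  under eq_fun do rewrite expr2.
  exact: cvgM.
pose S n := ereal_sup [set (`|RL (beta n) (alpha n) phi psi g x - g x|
                    / (1 + x ^+ 2) `^ (1 + l))%:E | x in `[0, +oo[%classic].
have S_ge0 n : (0 <= S n)%E.
  apply: (@le_trans _ _ (`|RL (beta n) (alpha n) phi psi g 0 - g 0|
                    / (1 + 0 ^+ 2) `^ (1 + l))%:E).
    by rewrite lee_fin divr_ge0// powR_ge0.
  apply: ereal_sup_ubound; exists 0 => //=.
  by rewrite in_itv/= lexx.
have S_le e : 0 < e -> \forall n \near \oo, (S n <= e%:E)%E.
  move=> e0; have e20 : 0 < e / 2 by rewrite divr_gt0.
  (* Half of e pays for the weighted term, the other half for K eta_n. As K depends on neither n nor
     x, one threshold for n serves every x. *)
  have [K K0 gK] := dist_le_weighted M (e / 2) l g M0 e20 l_gt0 cg gM.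
  have Keta : K * eta n @[n --> \oo] --> (0 : R).
    by rewrite -(mulr0 K); exact: cvgMr.
  near=> n.
  have b0 : 0 < beta n by near: n; exact: beta_gt0.
  have a0 : 0 <= alpha n by apply: alpha_ge0; near: n; exact: nbhs_infty_gt.
  have Ke : K * eta n <= e / 2.
    apply: le_trans (ler_norm _) _; near: n.
    by move/cvgr0Pnorm_le : Keta; apply.
  apply/ereal_supP => y [x]; rewrite /= in_itv/= andbT => x0 <- {y}.
  rewrite lee_fin -/(w x).
  have w1 : 1 <= w x by rewrite /w lerDl sqr_ge0.
  have w0 : 0 < w x by exact: lt_le_trans w1.
  rewrite ler_pdivrMr ?powR_gt0//.
  (* At each fixed x, the constant term of the quadratic estimate is taken to be e/2 (w x)^(1+l). *)
  have := @RL_dist _ (beta n) (alpha n) phi psi (e / 2 * w x `^ (1 + l)) K x g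
    b0 a0 phi_ge0 phi_le_psi x0 K0 cg (fun T => gK x T x0).
  move=> /le_trans; apply.
  rewrite [leRHS](_ : _ = e / 2 * w x `^ (1 + l) + e / 2 * w x `^ (1 + l)).
    rewrite lerD2l.
    have wl : w x <= w x `^ (1 + l).
      by rewrite -{1}(powRr1 (ltW w0)) ler_powR// lerDl ltW.
    have := RL_error_le (beta n) (alpha n) x phi psi b0 a0 x0.
    move=> /(ler_wpM2l K0)/le_trans; apply.
    rewrite -/(eta n) mulrA; apply: (@le_trans _ _ (e / 2 * w x)).
      by rewrite ler_wpM2r// ltW.
    by rewrite ler_wpM2l// ltW.
  by rewrite -mulrDl -splitr.
(* An extended real limit amounts to eventual finiteness, given by 0 <= S n <= 1 for large n,
   together with convergence of the real values. *)
rewrite -/S; apply/fine_cvgP; split.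
  near=> n; rewrite ge0_fin_numE//.
  by apply: (@le_lt_trans _ _ 1%:E); [near: n; exact: S_le|exact: ltry].
apply/cvgrPdist_le => e e0; near=> n.
rewrite sub0r normrN ger0_norm ?fine_ge0//.
have Se : (S n <= e%:E)%E by near: n; exact: S_le.
by rewrite -lee_fin fineK// ge0_fin_numE// (le_lt_trans Se)// ltry.
Unshelve. all: by end_near.
Qed.
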